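(* Let $a<b$ be real, $n\ge 1$. Suppose $x\in W^{3,2}[a,b]$ is $\mathbb{R}^n$-valued and $$B\begin{bmatrix}x(a)^T& x(b)^T& x_s(a)^T& x_s(b)^T\end{bmatrix}^T=0,$$ where $B\in\mathbb{R}^{2n\times 4n}$ has row rank $2n$. Then for all $s\in[a,b]$, $$x(s)=\int_a^b B_a(s,\eta)x_{ss}(\eta)\,d\eta+\int_a^s (s-\eta)x_{ss}(\eta)\,d\eta,$$ $$x_s(s)=\int_a^b B_b(\eta)x_{ss}(\eta)\,d\eta+\int_a^s x_{ss}(\eta)\,d\eta,$$ where $$B_a(s,\eta)=B_4(s)(b-\eta)+B_5(s),\qquad B_b(\eta)=B_6(b-\eta)+B_7,$$ $$\begin{bmatrix}B_6&B_7\end{bmatrix}=\begin{bmatrix}0&I\end{bmatrix}B_3,\qquad \begin{bmatrix}B_4(s)&B_5(s)\end{bmatrix}=\begin{bmatrix}I&(s-a)I\end{bmatrix}B_3,$$ $$B_3=-B_2^{-1}B\begin{bmatrix}0&0\\ I&0\\ 0&0\\ 0&I\end{bmatrix},\qquad B_2=B\begin{bmatrix}I&0\\ I&(b-a)I\\ 0&I\\ 0&I\end{bmatrix}.$$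
   Context: $I$ and $0$ denote $n\times n$ identity and zero blocks; $B_4(s),B_5(s),B_6,B_7$ are $n\times n$ blocks. $x_s,x_{ss}$ denote the first and second derivatives of $x$ with respect to $s$. $W^{k,2}[a,b]$ is the Sobolev space of ($\mathbb{R}^n$-valued) functions whose derivatives up to order $k$ lie in $L_2[a,b]$.
   Formalization: Invertibility of B_2 is added as a hypothesis: row rank 2n of B does not imply it (periodic conditions x(a)=x(b), x_s(a)=x_s(b) give a singular B_2), and B_2^{-1} is otherwise undefined. *)

(* Defs.v *)
From HB Require Import structures.
From mathcomp Require Import all_boot all_order all_algebra.
From mathcomp Require Import all_classical all_reals all_analysis.

Set Implicit Arguments.
Unset Strict Implicit.
Unset Printing Implicit Defensive.

Import Order.TTheory GRing.Theory Num.Theory.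
Import numFieldNormedType.Exports.

Local Open Scope classical_set_scope.
Local Open Scope ring_scope.

Section Sobolev.
Context {R : realType}.

Definition test_function (a b : R) (phi : R -> R) : Prop :=
  [/\ forall (k : nat) (t : R), derivable (derive1n k phi) t 1,
      compact (closure [set t | phi t != 0])
    & closure [set t | phi t != 0] `<=` `]a, b[].

Context {n : nat}.

(* Entrywise Lebesgue integral over [a, b]. *)
Definition integral_cV (a b : R) (f : R -> 'cV[R]_n) : 'cV[R]_n :=
  \col_i \int[lebesgue_measure]_(t in `[a, b]) f t i 0.

(* Only the values on [a, b] matter: each entry is extended by 0 outside. *)
Definition in_L2 (a b : R) (f : R -> 'cV[R]_n) : Prop :=
  forall i, (fun t => f t i 0) \_ `[a, b] \in Lfun lebesgue_measure 2%:E.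

(* g represents the j-th distributional derivative of f on ]a, b[, both f and
   g being square integrable. *)
Definition weak_derivative (a b : R) (j : nat) (f g : R -> 'cV[R]_n) : Prop :=
  [/\ in_L2 a b f, in_L2 a b g
    & forall phi, test_function a b phi ->
        integral_cV a b (fun t => derive1n j phi t *: f t) =
        (-1) ^+ j *: integral_cV a b (fun t => phi t *: g t)].

(* W^{k,2}[a, b]; for j = 0, g := f is a witness. *)
Definition sobolev2 (a b : R) (k : nat) (f : R -> 'cV[R]_n) : Prop :=
  in_L2 a b f /\
  forall j, (j <= k)%N -> exists g, weak_derivative a b j f g.

End Sobolev.

Section BoundaryMatrices.
Context {R : realType} {n : nat} (a b : R).
Implicit Types (s eta : R).

(* The dimensions 2n and 4n are written n + n and (n + n) + (n + n) so that
   the n x n block structure is carried by the types. *)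
Variable B : 'M[R]_(n + n, (n + n) + (n + n)).

Definition mxB2 : 'M[R]_(n + n) :=
  B *m col_mx (col_mx (row_mx 1%:M 0) (row_mx 1%:M (b - a)%:M))
              (col_mx (row_mx 0 1%:M) (row_mx 0 1%:M)).

(* invmx is an inverse only for matrices in unitmx. *)
Definition mxB3 : 'M[R]_(n + n) :=
  - invmx mxB2 *m
    (B *m col_mx (col_mx (row_mx 0 0) (row_mx 1%:M 0))
                 (col_mx (row_mx 0 0) (row_mx 0 1%:M))).

Definition mxB45 s : 'M[R]_(n, n + n) := row_mx 1%:M (s - a)%:M *m mxB3.
Definition mxB67 : 'M[R]_(n, n + n) := row_mx 0 1%:M *m mxB3.

Definition mxB4 s : 'M[R]_n := lsubmx (mxB45 s).
Definition mxB5 s : 'M[R]_n := rsubmx (mxB45 s).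
Definition mxB6 : 'M[R]_n := lsubmx mxB67.
Definition mxB7 : 'M[R]_n := rsubmx mxB67.

Definition mxBa s eta : 'M[R]_n := (b - eta) *: mxB4 s + mxB5 s.
Definition mxBb eta : 'M[R]_n := (b - eta) *: mxB6 + mxB7.

End BoundaryMatrices.

(* Main.v *)
(* If a continuous f has an integrable weak derivative g on ]a, b[, then
   f t - f a = \int_a^t g (du Bois-Reymond): test the weak identity against
   smooth approximations of the indicator of ]a, t[, whose derivatives are two
   approximate identities of opposite signs concentrating at a and at t.
   For xs this is the claim xs s - xs a = \int_a^s xss. Since (s - eta) is smooth,
   (s - eta) xs(eta) has the weak derivative (s - eta) xss(eta) - xs(eta), and the
   same result yields Taylor's formula for x without Fubini or integration by
   parts. With J = \int_a^b (b - eta) xss and K = \int_a^b xss, Taylor's formula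
   at b turns the boundary condition into B2 (x a, xs a) = - B (0, J, 0, K), so
   that inverting B2 gives (x a, xs a) = B3 (J, K). *)

Require Import Defs.
From HB Require Import structures.
From mathcomp Require Import all_boot all_order all_algebra.
From mathcomp Require Import all_classical all_reals all_analysis.
From mathcomp Require Import measurable_realfun ring lra.

Set Implicit Arguments.
Unset Strict Implicit.
Unset Printing Implicit Defensive.

Import Order.TTheory GRing.Theory Num.Theory.
Import numFieldNormedType.Exports.

Local Open Scope classical_set_scope.
Local Open Scope ring_scope.

(** * Smooth real functions and a monotone smooth step from 0 to 1 *)

Section Smooth.
Context {R : realType}.
Implicit Types (f g : R -> R) (x t : R) (k : nat).

(** Differentiates from the inside, whereas [derive1n] adds each new derivative on the outside.
    After one step the claim is about [derive1 f], again a sum or product, so induction on [k] with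
    [f] generalized goes through. *)
Fixpoint derivable_upto k f : Prop :=
  if k is k'.+1 then (forall x, derivable f x 1) /\ derivable_upto k' (derive1 f)
  else True.

Definition smooth f : Prop := forall k x, derivable (derive1n k f) x 1.

Lemma smoothP f : smooth f <-> forall k, derivable_upto k f.
Proof.
split=> [fs k|fs k].
  elim: k f fs => //= k IH f fs; split; first exact: (fs 0%N).
  by apply: IH => j x; rewrite -derive1Sn; exact: fs.
elim: k f fs => [|k IH] f fs x; first exact: (fs 1%N).1.
by rewrite derive1Sn; apply: IH => j; exact: (fs j.+1).2.
Qed.

Lemma derivable_uptoW k f : derivable_upto k.+1 f -> derivable_upto k f.
Proof. by elim: k f => //= k IH f [? [? ?]]; split => //; exact: IH. Qed.

Lemma derivable_upto_cst k (c : R) : derivable_upto k (cst c).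
Proof.
elim: k c => //= k IH c; split; first by move=> x; exact: derivable_cst.
by rewrite (_ : derive1 _ = cst 0)//; apply/funext => x; exact: derive1_cst.
Qed.

Lemma derive1D f g x : derivable f x 1 -> derivable g x 1 ->
  derive1 (f \+ g) x = derive1 f x + derive1 g x.
Proof. by move=> df dg; rewrite !derive1E; exact: (deriveD df dg). Qed.

Lemma derive1M f g x : derivable f x 1 -> derivable g x 1 ->
  derive1 (f \* g) x = f x * derive1 g x + g x * derive1 f x.
Proof. by move=> df dg; rewrite !derive1E; exact: (deriveM df dg). Qed.

Lemma derive1V f x : f x != 0 -> derivable f x 1 ->
  derive1 (fun x => (f x)^-1) x = - ((f x)^-1 ^+ 2) * derive1 f x.
Proof.
by move=> f0 df; rewrite !derive1E exprVn; exact: (deriveV f0 df).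
Qed.

Lemma derive1_div f g x : derivable f x 1 -> derivable g x 1 -> g x != 0 ->
  derive1 (fun x => f x / g x) x =
  (g x)^-1 ^+ 2 * (derive1 f x * g x - f x * derive1 g x).
Proof.
move=> df dg g0.
have dV : derivable (fun x => (g x)^-1) x 1 by exact: (derivableV g0 dg).
rewrite (derive1M df dV) (derive1V g0 dg).
by field.
Qed.

Lemma is_derive_affine f (c d : R) x : (forall x, derivable f x 1) ->
  is_derive x 1 (fun t => f (c * t + d)) (c * derive1 f (c * x + d)).
Proof.
move=> df.
have da : is_derive x 1 (fun t => c * t + d : R) c.
  by apply: is_derive_eq; rewrite -[LHS]/(c * 1 + 0) mulr1 addr0.
have [da1 da2] := da.
apply: DeriveDef.
  apply/derivable1_diffP.
  apply: (@differentiable_comp _ _ _ _ (fun t => c * t + d)).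
    exact/derivable1_diffP.
  exact/derivable1_diffP/df.
have := @derive1_comp R (fun t => c * t + d) f x da1 (df _).
by rewrite [X in _ * X]derive1E da2 mulrC => <-; rewrite derive1E.
Qed.

Lemma derivable_uptoD k f g : derivable_upto k f -> derivable_upto k g ->
  derivable_upto k (f \+ g).
Proof.
elim: k f g => //= k IH f g [df kf] [dg kg]; split.
  by move=> x; exact: (derivableD (df x) (dg x)).
rewrite (_ : derive1 _ = derive1 f \+ derive1 g); first exact: IH.
by apply/funext => x; rewrite derive1D.
Qed.

Lemma derivable_uptoM k f g : derivable_upto k f -> derivable_upto k g ->
  derivable_upto k (f \* g).
Proof.
elim: k f g => //= k IH f g [df kf] [dg kg]; split.
  by move=> x; exact: (derivableM (df x) (dg x)).
rewrite (_ : derive1 _ = (f \* derive1 g) \+ (g \* derive1 f)).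
  by apply: derivable_uptoD; apply: IH => //; exact: derivable_uptoW.
by apply/funext => x; rewrite derive1M.
Qed.

Lemma derivable_uptoZ k (c : R) f : derivable_upto k f ->
  derivable_upto k (fun x => c * f x).
Proof.
by move=> kf; apply: (@derivable_uptoM k (cst c)) => //; exact: derivable_upto_cst.
Qed.

(** The derivative [- f^-2 * f'] involves the inverse of the same [f], so the induction on [k] keeps
    [f] fixed and leaves the rest to the product rule. *)
Lemma derivable_uptoV k f : (forall x, f x != 0) -> derivable_upto k f ->
  derivable_upto k (fun x => (f x)^-1).
Proof.
move=> f0; elim: k => //= k IH [df kf]; split.
  by move=> x; exact: (derivableV (f0 x) (df x)).
rewrite (_ : derive1 _ =
    (fun x => -1 * ((f x)^-1 * (f x)^-1)) \* derive1 f).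
  apply: derivable_uptoM => //; apply: derivable_uptoZ.
  by apply: derivable_uptoM; apply: IH; exact: derivable_uptoW.
by apply/funext => x; rewrite derive1V//= mulN1r expr2.
Qed.

Lemma derivable_upto_affine k f (c d : R) : derivable_upto k f ->
  derivable_upto k (fun t => f (c * t + d)).
Proof.
elim: k f => //= k IH f [df kf].
have da x := is_derive_affine c d x df.
split; first by move=> x; have [] := da x.
rewrite (_ : derive1 _ = fun x => c * derive1 f (c * x + d)).
  by apply: derivable_uptoZ; exact: (IH (derive1 f)).
by apply/funext => x; rewrite derive1E; have [] := da x.
Qed.

Lemma smoothM f g : smooth f -> smooth g -> smooth (f \* g).
Proof.
by move=> /smoothP fs /smoothP gs; apply/smoothP => k; exact: derivable_uptoM.
Qed.

Lemma smooth_derive f : smooth f -> smooth (derive1 f).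
Proof. by move=> fs k x; rewrite -derive1Sn; exact: fs. Qed.

(** The bound forces [f 0 = 0], and the difference quotient at 0 is then at most [C * |h|]. This
    settles the differentiability of [flat] at its gluing point. *)
Lemma is_derive_quadratic f (C : R) : (forall t, `|f t| <= C * t ^+ 2) ->
  is_derive (0 : R) 1 f 0.
Proof.
move=> fC.
have f0 : f 0 = 0.
  by apply/eqP; rewrite -normr_le0 (le_trans (fC 0))// expr2 !mulr0.
have C0 : 0 <= C.
  by have := le_trans (normr_ge0 _) (fC 1); rewrite expr1n mulr1.
have lim0 : h^-1 *: ((f \o shift 0) (h *: (1 : R)) - f 0) @[h --> 0^'] --> (0 : R).
  apply/cvgr0Pnorm_le => e e0.
  near=> h.
  have h0 : h != 0 by near: h; exact: nbhs_dnbhs_neq.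
  rewrite /= f0 subr0 addr0 [h *: 1]mulr1 normrZ normfV.
  rewrite ler_pdivrMl ?normr_gt0// (le_trans (fC h))//.
  rewrite -real_normK ?num_real// expr2 mulrCA ler_wpM2l//.
  (* [C + 1] replaces [C] so that the divisor stays positive when [C = 0]. *)
  rewrite (le_trans (_ : _ <= (C + 1) * `|h|))//.
    by rewrite ler_wpM2r// lerDl.
  rewrite -ler_pdivlMl ?ltr_wpDl//.
  near: h; apply: dnbhs0_le.
  by rewrite mulr_gt0 ?invr_gt0 ?ltr_wpDl.
apply: DeriveDef; first by apply/cvg_ex; exists 0.
exact: cvg_lim lim0.
Unshelve. all: by end_near. Qed.

(* All derivatives at 0 vanish, and the family is closed under differentiation up
   to linear combinations: flat_k' = flat_(k+2) - k flat_(k+1). *)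
Definition flat k x : R := if 0 < x then x^-1 ^+ k * expR (- x^-1) else 0.

(** With [y = 1/x], one term of the exponential series gives [y^(k+2) / (k+2)! <= exp y]; two of the
    powers of [y] are traded for [x^2]. *)
Lemma flat_quadratic k x : `|flat k x| <= k.+2`!%:R * x ^+ 2.
Proof.
rewrite /flat; case: ifPn => [x0|_]; last first.
  by rewrite normr0 mulr_ge0// sqr_ge0.
have y0 : 0 < x^-1 by rewrite invr_gt0.
rewrite ger0_norm ?mulr_ge0 ?expR_ge0 ?exprn_ge0 ?(ltW y0)//.
rewrite expRN ler_pdivrMr ?expR_gt0//.
have := expR_ge1Dxn k.+1 (ltW y0); set E := expR _ => hE.
have : x^-1 ^+ k.+2 <= k.+2`!%:R * E.
  rewrite -ler_pdivrMl ?ltr0n ?fact_gt0// mulrC (le_trans _ hE)//.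
  by rewrite lerDr.
move=> h; rewrite mulrAC -ler_pdivrMr ?exprn_gt0//.
by rewrite -exprVn -exprD addn2.
Qed.

Lemma is_derive_flat k x :
  is_derive x 1 (flat k) (flat k.+2 x + - k%:R * flat k.+1 x).
Proof.
have [x0|x0|->] := ltgtP x 0.
- rewrite {2 3}/flat ltNge (ltW x0)/= mulr0 addr0.
  apply: (@near_eq_is_derive _ _ _ (cst 0)) => //.
  near=> t; rewrite /flat ltNge ltW//=.
  by near: t; exact: lt_nbhsl.
- rewrite {2 3}/flat x0.
  apply: (@near_eq_is_derive _ _ _ (fun t => t^-1 ^+ k * expR (- t^-1))) => //.
    near=> t; rewrite /flat ifT//.
    by near: t; exact: lt_nbhsr.
  have xn0 : x != 0 by rewrite gt_eqF.
  have dV : is_derive x 1 (fun t : R => t^-1) (- (x^-1 ^+ 2)).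
    apply: DeriveDef; first exact: derivableV.
    rewrite deriveV// derive_id.
    by rewrite -[LHS]/(- x ^- 2 * 1) mulr1 exprVn.
  have dE : is_derive x 1 (fun t : R => expR (- t^-1)) (x^-1 ^+ 2 * expR (- x^-1)).
    by apply: is_derive_eq; rewrite opprK mulrC.
  rewrite (_ : (fun t => _) =
      (fun t => t^-1) ^+ k * (fun t => expR (- t^-1))); last first.
    by apply/funext => t; rewrite fctE exprfctE.
  apply: (is_derive_eq (is_deriveM (is_deriveX k dV) dE)).
  rewrite exprfctE.
  rewrite -[LHS]/(x^-1 ^+ k * (x^-1 ^+ 2 * expR (- x^-1)) +
    expR (- x^-1) * (k%:R * x^-1 ^+ k.-1 * (- x^-1 ^+ 2))).
  rewrite mulrA -exprD addn2; congr (_ + _).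
  (* [k = 0] is separate because [k.-1] truncates; the coefficient [k%:R] is then zero on both
     sides. *)
  case: k => [|k]; first by rewrite oppr0 !mul0r mulr0.
  by rewrite /= -[k.+2]addn2 exprD; ring.
(* At the gluing point no formula is differentiated: the quadratic bound alone gives derivative
   0. *)
- rewrite {2 3}/flat ltxx mulr0 addr0.
  exact: is_derive_quadratic (flat_quadratic k).
Unshelve. all: by end_near. Qed.

Lemma derivable_upto_flat m k : derivable_upto m (flat k).
Proof.
elim: m k => //= m IH k; split.
  by move=> x; have [] := is_derive_flat k x.
rewrite (_ : derive1 _ = flat k.+2 \+ (fun x => - k%:R * flat k.+1 x)).
  by apply: derivable_uptoD => //; exact: derivable_uptoZ.
by apply/funext => x; rewrite derive1E; have [] := is_derive_flat k x.
Qed.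

Definition smoothstep x : R := flat 0 x / (flat 0 x + flat 0 (1 - x)).

Lemma flat0_ge0 x : 0 <= flat 0 x.
Proof. by rewrite /flat; case: ifP => // _; rewrite mul1r expR_ge0. Qed.

Lemma flat0_gt0 x : 0 < x -> 0 < flat 0 x.
Proof. by move=> x0; rewrite /flat x0 mul1r expR_gt0. Qed.

Lemma flat_le0 k x : x <= 0 -> flat k x = 0.
Proof. by rewrite /flat leNgt => /negbTE ->. Qed.

(** [x] and [1 - x] cannot both be nonpositive, so one of the two summands is positive. *)
Lemma smoothstep_den_gt0 x : 0 < flat 0 x + flat 0 (1 - x).
Proof.
have [x0|x0] := ltP 0 x; first by rewrite ltr_pwDl ?flat0_gt0 ?flat0_ge0.
by rewrite ltr_wpDl ?flat0_ge0// flat0_gt0// subr_gt0 (le_lt_trans x0).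
Qed.

Lemma smoothstep_le0 x : x <= 0 -> smoothstep x = 0.
Proof. by move=> x0; rewrite /smoothstep flat_le0// mul0r. Qed.

Lemma smoothstep_ge1 x : 1 <= x -> smoothstep x = 1.
Proof.
move=> x1; rewrite /smoothstep [flat 0 (1 - x)]flat_le0 ?subr_le0// addr0.
by rewrite divff// gt_eqF// flat0_gt0// (lt_le_trans _ x1).
Qed.

Lemma smoothstep_ge0_le1 x : 0 <= smoothstep x <= 1.
Proof.
have d0 := smoothstep_den_gt0 x.
rewrite /smoothstep divr_ge0 ?flat0_ge0 ?(ltW d0)//=.
by rewrite ler_pdivrMr// mul1r lerDl flat0_ge0.
Qed.

Lemma smooth_smoothstep : smooth smoothstep.
Proof.
apply/smoothP => k; apply: derivable_uptoM; first exact: derivable_upto_flat.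
apply: derivable_uptoV => [x|]; first by rewrite gt_eqF// smoothstep_den_gt0.
apply: derivable_uptoD; first exact: derivable_upto_flat.
rewrite (_ : (fun _ => _) = fun x => flat 0 (-1 * x + 1)).
  exact/derivable_upto_affine/derivable_upto_flat.
by apply/funext => x; rewrite mulN1r addrC.
Qed.

(** This sign lets derivatives of steps act as nonnegative averaging kernels. It follows from the
    quotient rule and [h' = flat 2 >= 0]. *)
Lemma derive1_smoothstep_ge0 x : 0 <= derive1 smoothstep x.
Proof.
pose h : R -> R := flat 0; pose k : R -> R := fun x => h (-1 * x + 1).
have dh y : derivable h y 1 by exact: (derivable_upto_flat 1 0).1.
have h'E y : derive1 h y = flat 2 y.
  by rewrite derive1E; have [_ ->] := is_derive_flat 0 y; rewrite oppr0 mul0r addr0.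
have [dk kE] := is_derive_affine (-1) 1 x dh.
rewrite -/k -derive1E h'E in kE; rewrite -/k in dk.
have D0 : h x + k x != 0.
  by rewrite /k /h mulN1r [- x + 1]addrC gt_eqF// smoothstep_den_gt0.
have dD : derivable (h \+ k) x 1 by exact: (derivableD (dh x) dk).
have -> : smoothstep = fun y => h y / (h \+ k) y.
  by apply/funext => y; rewrite /smoothstep /k/= mulN1r [- y + 1]addrC.
rewrite (derive1_div (dh x) dD D0) (derive1D (dh x) dk) kE h'E/=.
have f2 y : 0 <= flat 2 y.
  by rewrite /flat; case: ifP => // _; rewrite mulr_ge0 ?expR_ge0 ?sqr_ge0.
have h0 : 0 <= h x by exact: flat0_ge0.
have k0 : 0 <= k x by exact: flat0_ge0.
set p := flat 2 x; set q := flat 2 _.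
(* The terms [h x * p] cancel, which leaves a sum of products of nonnegative factors. *)
have -> : p * (h x + k x) - h x * (p + -1 * q) = p * k x + h x * q by ring.
by rewrite mulr_ge0 ?sqr_ge0// addr_ge0// mulr_ge0 ?f2.
Qed.

End Smooth.

(** * Test functions, rescaled steps, and step derivatives as averaging kernels *)

Section Steps.
Context {R : realType}.
Implicit Types (f g phi p : R -> R) (a b c d x t u : R).
Notation mu := (@lebesgue_measure R).

Lemma derive1_near_cst f (c : R) x : (\forall t \near x, f t = c) ->
  derive1 f x = 0.
Proof.
move=> fc; rewrite derive1E.
by rewrite (@near_eq_derive _ _ _ f (cst c))// derive_cst.
Qed.

Lemma smooth_continuous f : smooth f -> continuous f.
Proof.
by move=> fs x; apply/differentiable_continuous/derivable1_diffP/(fs 0%N).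
Qed.

(** The closed interval [[c, d]] absorbs the closure of the support, and the strict margins keep it
    inside the open interval. *)
Lemma test_functionE a b c d phi : a < c -> d < b -> smooth phi ->
  (forall t, t < c \/ d < t -> phi t = 0) -> test_function a b phi.
Proof.
move=> ac db phis phi0.
have sub : closure [set t | phi t != 0] `<=` `[c, d].
  rewrite [X in _ `<=` X](closure_id _).1; last exact: itv_closed.
  apply: closureS => t /= /eqP pt; rewrite in_itv/= !leNgt.
  by apply/andP; split; apply/negP => h; apply: pt; apply: phi0; tauto.
split => //.
- apply: (subclosed_compact (@closed_closure _ _) (@segment_compact _ c d)) => //.
- apply: subset_trans sub _ => t /=; rewrite !in_itv/= => /andP[ct td].
  by rewrite (lt_le_trans ac)// (le_lt_trans td).
Qed.

Lemma test_function_sub a b phi psi : test_function a b phi -> smooth psi ->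
  [set t | psi t != 0] `<=` closure [set t | phi t != 0] ->
  test_function a b psi.
Proof.
move=> [phis cphi iphi] psis sub.
have csub : closure [set t | psi t != 0] `<=` closure [set t | phi t != 0].
  by rewrite [X in _ `<=` X](closure_id _).1; [exact: closureS|exact: closed_closure].
split => //; last exact: subset_trans csub _.
exact: (subclosed_compact (@closed_closure _ _) cphi).
Qed.

(** Off its closed support [phi] is zero on a whole neighbourhood, so its derivative vanishes there
    too and the support does not grow. *)
Lemma test_function_derive a b phi : test_function a b phi ->
  test_function a b (derive1 phi).
Proof.
move=> tphi; apply: (test_function_sub tphi); first by apply: smooth_derive; case: tphi.
move=> t /= /eqP dt; apply: contrapT => ct; apply: dt.
apply: (@derive1_near_cst _ 0).
have : open (~` closure [set t | phi t != 0]).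
  by rewrite openC; exact: closed_closure.
rewrite openE => /(_ _ ct); apply: filterS => u cu.
by apply: contrapT => /eqP pu; apply: cu; exact: subset_closure.
Qed.

Lemma test_functionM a b phi p : test_function a b phi -> smooth p ->
  test_function a b (phi \* p).
Proof.
move=> tphi ps; have [phis _ _] := tphi.
apply: (test_function_sub tphi (smoothM phis ps)).
move=> t /=; rewrite mulf_eq0 negb_or => /andP[pt _]; exact: subset_closure.
Qed.

(** [(u - c) / (d - c)] is expanded into the form [c' * u + d'] to which the affine substitution
    lemmas apply. *)
Definition step c d u : R := smoothstep ((d - c)^-1 * u + - (c / (d - c))).

Lemma smooth_step c d : smooth (step c d).
Proof.
apply/smoothP => k; apply: (@derivable_upto_affine _ k smoothstep).
by have /smoothP := @smooth_smoothstep R.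
Qed.

Lemma step_le c d u : c < d -> u <= c -> step c d u = 0.
Proof.
move=> cd uc; rewrite /step smoothstep_le0//.
by rewrite mulrC -mulrBl mulr_le0_ge0// ?subr_le0// invr_ge0 subr_ge0 ltW.
Qed.

Lemma step_ge c d u : c < d -> d <= u -> step c d u = 1.
Proof.
move=> cd du; rewrite /step smoothstep_ge1//.
by rewrite mulrC -mulrBl ler_pdivlMr ?subr_gt0// mul1r lerB.
Qed.

Lemma derive1_step_ge0 c d u : c < d -> 0 <= derive1 (step c d) u.
Proof.
move=> cd.
have [_] := @is_derive_affine R (@smoothstep R) (d - c)^-1 (- (c / (d - c))) u
  (fun x => @smooth_smoothstep R 0%N x).
rewrite -derive1E => ->; rewrite mulr_ge0 ?invr_ge0 ?subr_ge0 ?(ltW cd)//.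
exact: derive1_smoothstep_ge0.
Qed.

Lemma derive1_step_out c d u : c < d -> u < c \/ d < u ->
  derive1 (step c d) u = 0.
Proof.
move=> cd [uc|du].
  apply: (@derive1_near_cst _ 0); near=> t; apply: step_le => //; apply: ltW.
  by near: t; exact: lt_nbhsl.
apply: (@derive1_near_cst _ 1); near=> t; apply: step_ge => //; apply: ltW.
by near: t; exact: lt_nbhsr.
Unshelve. all: by end_near. Qed.

Lemma continuous_itv_integrable a b f : {within `[a, b], continuous f} ->
  mu.-integrable `[a, b] (EFin \o f).
Proof. by apply: continuous_compact_integrable; exact: segment_compact. Qed.

Lemma within_continuousM a b f g : {within `[a, b], continuous f} ->
  {within `[a, b], continuous g} -> {within `[a, b], continuous (f \* g)}.
Proof. by move=> cf cg x; apply: cvgM; [exact: cf|exact: cg]. Qed.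

(** A continuous factor is measurable and, by compactness of [[a, b]], bounded. *)
Lemma integrable_continuousM a b p g : continuous p ->
  mu.-integrable `[a, b] (EFin \o g) ->
  mu.-integrable `[a, b] (EFin \o (p \* g)).
Proof.
move=> cp ig.
have -> : EFin \o (p \* g) = ((EFin \o p) \* (EFin \o g))%E.
  by apply/funext => x; rewrite /= EFinM.
apply: integrableMr => //.
  apply: subspace_continuous_measurable_fun => //; exact: continuous_subspaceT.
have [M [_ hM]] := compact_bounded
  (continuous_compact (continuous_subspaceT cp) (@segment_compact _ a b)).
by exists M; split; rewrite ?num_real// => ? ? ? ?; exact: hM.
Qed.

(** By the fundamental theorem of calculus the integral is the total rise of the step. With
    [derive1_step_ge0] and [derive1_step_out], the derivative is thus a probability density carried
    by [[c, d]]. *)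
Lemma integral_derive_step a b c d : a < b -> a <= c -> c < d -> d <= b ->
  \int[mu]_(t in `[a, b]) derive1 (step c d) t = 1.
Proof.
move=> ab ac cd db.
have cs : continuous (step c d) by apply: smooth_continuous; exact: smooth_step.
have cs' : continuous (derive1 (step c d)).
  by apply: smooth_continuous; apply: smooth_derive; exact: smooth_step.
rewrite /Rintegral (@continuous_FTC2 _ _ (step c d))//=.
- by rewrite step_ge// step_le// subr0.
- exact: continuous_subspaceT.
- split; first by move=> x _; exact: (@smooth_step c d 0%N).
    by apply: cvg_at_right_filter; exact: cs.
  by apply: cvg_at_left_filter; exact: cs.
Qed.

(** An average of [f] against a density carried by [[c, d]] is as close to [y] as [f] is on
    [[c, d]]. Since the density has mass 1, [y] and [eta] can be moved under the integral. *)
Lemma integral_derive_stepM a b c d f (y eta : R) : a < b -> a <= c -> c < d ->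
  d <= b -> {within `[a, b], continuous f} ->
  (forall u, c <= u <= d -> `|f u - y| <= eta) ->
  `|\int[mu]_(t in `[a, b]) (derive1 (step c d) t * f t) - y| <= eta.
Proof.
move=> ab ac cd db cf fy.
have cs' : continuous (derive1 (step c d)).
  by apply: smooth_continuous; apply: smooth_derive; exact: smooth_step.
have is' : mu.-integrable `[a, b] (EFin \o derive1 (step c d)).
  by apply: continuous_itv_integrable; exact: continuous_subspaceT.
have isf : mu.-integrable `[a, b] (EFin \o (derive1 (step c d) \* f)).
  by apply: integrable_continuousM => //; exact: continuous_itv_integrable.
have isy z : mu.-integrable `[a, b] (EFin \o (fun t => derive1 (step c d) t * z)).
  apply: (@integrable_continuousM _ _ _ (cst z)) => //.
  by apply: continuous_itv_integrable; apply: continuous_subspaceT => x; exact: cvg_cst.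
have -> : \int[mu]_(t in `[a, b]) (derive1 (step c d) t * f t) - y =
    \int[mu]_(t in `[a, b]) (derive1 (step c d) t * (f t - y)).
  under [RHS]eq_Rintegral do rewrite mulrBr.
  by rewrite RintegralB// RintegralZr// integral_derive_step// mul1r.
have -> : eta = \int[mu]_(t in `[a, b]) (derive1 (step c d) t * eta).
  by rewrite RintegralZr// integral_derive_step// mul1r.
have isd : mu.-integrable `[a, b]
    (EFin \o (fun t => derive1 (step c d) t * (f t - y))).
  have /(_ (measurable_itv _)) := fun m => integrableB m isf (isy y).
  by apply: eq_integrable => // t _; rewrite /= mulrBr EFinB.
apply: le_trans (le_normr_Rintegral _ isd) _ => //.
apply: le_Rintegral => //; first exact: integrable_norm.
move=> t _; rewrite normrM ger0_norm ?derive1_step_ge0//.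
(* Nothing is known about [f] outside [[c, d]], but there the density is zero. *)
have [tc|ct] := ltP t c.
  by rewrite derive1_step_out ?mul0r//; left.
have [dt|td] := ltP d t.
  by rewrite derive1_step_out ?mul0r//; right.
by rewrite ler_wpM2l ?derive1_step_ge0// fy// ct.
Qed.

End Steps.

(** * Smooth cutoffs of []a, t[] and the du Bois-Reymond lemma *)

Section DuBoisReymond.
Context {R : realType}.
Implicit Types (f g phi p : R -> R) (a b c d x t u : R).
Notation mu := (@lebesgue_measure R).

Lemma step_ge0_le1 c d u : 0 <= step c d u <= 1.
Proof. exact: smoothstep_ge0_le1. Qed.

(** The epsilon-delta form of continuity on the subspace, usable also at the end points, where only
    one side is controlled. *)
Lemma within_continuous_dist a b f t (eta : R) : {within `[a, b], continuous f} ->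
  a <= t <= b -> 0 < eta ->
  exists2 del : R, 0 < del &
    forall u, a <= u <= b -> `|u - t| < del -> `|f u - f t| <= eta.
Proof.
move=> cf atb eta0.
have tab : `[a, b]%classic t by rewrite /= in_itv.
have := cf t => /(_ _ (nbhsx_ballx (f t) eta eta0)).
rewrite /= /nbhs/= -nbhs_subspace_in// /within/= => -[del /= del0 sub].
exists del => // u aub ut; rewrite distrC ltW//.
by apply: sub; rewrite /= ?in_itv// distrC.
Qed.

Section cutoff.
Variables (a t : R).
Hypothesis at_ : a < t.

(** Positivity keeps the supports off [a] and [t]. As [harmonic n <= 1], the factor [1/4] gives
    [a + 2 e n <= t - 2 e n], so the rise ends before the fall begins. *)
Let e (n : nat) : R := (t - a) / 4 * harmonic n.

Let e_gt0 n : 0 < e n.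
Proof. by rewrite mulr_gt0 ?harmonic_gt0// divr_gt0// subr_gt0. Qed.

Let e_le n : e n <= (t - a) / 4.
Proof.
rewrite ler_piMr ?divr_ge0 ?subr_ge0 ?(ltW at_)//.
by rewrite /= invf_le1// ler1n.
Qed.

Let near_e del : 0 < del -> \forall n \near \oo, 2 * e n < del.
Proof.
move=> del0.
have : 2 * e n @[n --> \oo] --> (2 * ((t - a) / 4 * 0) : R).
  by do 2 (apply: cvgM; first exact: cvg_cst); exact: cvg_harmonic.
by rewrite !mulr0 => /cvgr_lt; apply.
Qed.

Let rise n := step (a + e n) (a + 2 * e n).
Let fall n := step (t - 2 * e n) (t - e n).

(** A difference of two steps, not a product, so that its derivative splits into one kernel near [a]
    and one near [t]. *)
Definition cutoff n : R -> R := rise n \+ (fun u => -1 * fall n u).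


Lemma smooth_cutoff n : smooth (cutoff n).
Proof.
have /smoothP s1 := @smooth_step R (a + e n) (a + 2 * e n).
have /smoothP s2 := @smooth_step R (t - 2 * e n) (t - e n).
by apply/smoothP => k; apply: derivable_uptoD => //; exact: derivable_uptoZ.
Qed.

Lemma test_function_cutoff b n : t <= b -> test_function a b (cutoff n).
Proof.
move=> tb; have := e_gt0 n; have := e_le n => el e0.
apply: (@test_functionE _ _ _ (a + e n) (t - e n)); [lra|lra| |].
  exact: smooth_cutoff.
rewrite /cutoff /rise /fall => u [uc|cu] /=.
  by rewrite !step_le; lra.
by rewrite !step_ge; lra.
Qed.

Lemma cutoff_norm_le1 n u : `|cutoff n u| <= 1.
Proof.
have := step_ge0_le1 (a + e n) (a + 2 * e n) u.
have := step_ge0_le1 (t - 2 * e n) (t - e n) u.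
rewrite ler_norml /cutoff /rise /fall/= => /andP[? ?] /andP[? ?].
by apply/andP; split; lra.
Qed.

(** The sequence is eventually constant at each point: zero for every [n] outside []a, t[], and one
    inside as soon as [2 e n] is below the distance to both ends. *)
Lemma cvg_cutoff u : cutoff n u @[n --> \oo] --> (\1_`]a, t[ u : R).
Proof.
apply: cvg_near_cst.
rewrite indicE; have [au|ua] := ltP a u; last first.
  rewrite memNset; last by rewrite /= in_itv/= ltNge ua.
  apply: nearW => n; have := e_gt0 n; have := e_le n => el e0.
  by rewrite /cutoff /rise /fall/= !step_le; lra.
have [ut|tu] := ltP u t; last first.
  rewrite memNset; last by rewrite /= in_itv/= [u < t]ltNge tu andbF.
  apply: nearW => n; have := e_gt0 n; have := e_le n => el e0.
  by rewrite /cutoff /rise /fall/= !step_ge; lra.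
rewrite mem_set; last by rewrite /= in_itv/= au.
near=> n.
have n1 : 2 * e n < u - a by near: n; apply: near_e; rewrite subr_gt0.
have n2 : 2 * e n < t - u by near: n; apply: near_e; rewrite subr_gt0.
have := e_gt0 n; have := e_le n => el e0.
by rewrite /cutoff /rise /fall/= step_ge ?step_le; lra.
Unshelve. all: by end_near. Qed.

Lemma cvg_integral_derive_cutoff b f : t <= b -> {within `[a, b], continuous f} ->
  \int[mu]_(u in `[a, b]) (derive1 (cutoff n) u * f u) @[n --> \oo] -->
  f a - f t.
Proof.
move=> tb cf.
have ab : a < b by exact: lt_le_trans tb.
apply/cvgrPdist_le => eps eps0.
have eps20 : 0 < eps / 2 by rewrite divr_gt0.
have aab : a <= a <= b by rewrite lexx ltW.
have atb : a <= t <= b by rewrite ltW.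
have [d1 d10 h1] := within_continuous_dist cf aab eps20.
have [d2 d20 h2] := within_continuous_dist cf atb eps20.
near=> n.
have n1 : 2 * e n < d1 by near: n; exact: near_e.
have n2 : 2 * e n < d2 by near: n; exact: near_e.
have := e_gt0 n; have := e_le n => el e0.
have icf : mu.-integrable `[a, b] (EFin \o f) by exact: continuous_itv_integrable.
have cs c d : continuous (derive1 (step c d)).
  by apply: smooth_continuous; apply: smooth_derive; exact: smooth_step.
(* The rising kernel lives within [2 e n < d1] of [a], the falling one within [2 e n < d2] of [t];
   each average costs [eps / 2]. *)
have r1 : `|\int[mu]_(u in `[a, b]) (derive1 (rise n) u * f u) - f a| <= eps / 2.
  apply: integral_derive_stepM => //; [lra|lra|lra|].
  move=> u /andP[? ?]; apply: h1; first by apply/andP; split; lra.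
  by rewrite ger0_norm; lra.
have r2 : `|\int[mu]_(u in `[a, b]) (derive1 (fall n) u * f u) - f t| <= eps / 2.
  apply: integral_derive_stepM => //; [lra|lra|lra|].
  move=> u /andP[? ?]; apply: h2; first by apply/andP; split; lra.
  by rewrite ler0_norm; lra.
have -> : \int[mu]_(u in `[a, b]) (derive1 (cutoff n) u * f u) =
    \int[mu]_(u in `[a, b]) (derive1 (rise n) u * f u) -
    \int[mu]_(u in `[a, b]) (derive1 (fall n) u * f u).
  rewrite -RintegralB; [|by []|exact: (integrable_continuousM (cs _ _) icf)..].
  apply: eq_Rintegral => u _; rewrite -mulrBl; congr (_ * _).
  have dr := @smooth_step R (a + e n) (a + 2 * e n) 0%N u.
  have df := @smooth_step R (t - 2 * e n) (t - e n) 0%N u.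
  have dc := @derivable_cst R R R (-1 : R) u 1.
  rewrite (derive1D dr (derivableM dc df)) (derive1M dc df).
  by rewrite derive1_cst mulr0 addr0 mulN1r.
have tri (p q v w : R) : `|p - v| <= eps / 2 -> `|q - w| <= eps / 2 ->
    `|v - w - (p - q)| <= eps.
  by rewrite !ler_norml => /andP[? ?] /andP[? ?]; apply/andP; split; lra.
exact: tri r1 r2.
Unshelve. all: by end_near. Qed.

(** Dominated convergence with bound [|g|], as the cutoffs have absolute value at most 1. *)
Lemma cvg_integral_cutoff b g : t <= b -> mu.-integrable `[a, b] (EFin \o g) ->
  \int[mu]_(u in `[a, b]) (cutoff n u * g u) @[n --> \oo] -->
  \int[mu]_(u in `[a, t]) g u.
Proof.
move=> tb ig.
have sub : (`]a, t[ : set R) `<=` `[a, b].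
  move=> u /=; rewrite !in_itv/= => /andP[au ut].
  by rewrite (ltW au) (le_trans (ltW ut)).
(* The cutoffs converge to the indicator of the open interval; its two end points are null sets. *)
have -> : \int[mu]_(u in `[a, t]) g u =
    \int[mu]_(u in `[a, b]) (\1_`]a, t[ u * g u).
  transitivity (\int[mu]_(u in `[a, b]) (g \_ `]a, t[) u); last first.
    by apply: eq_Rintegral => u _; rewrite patch_indic/= mulrC.
  rewrite -Rintegral_mkcondr setIidr//.
  rewrite Rintegral_itv_obnd_cbnd; last exact: integrableS ig.
  rewrite Rintegral_itv_bndo_bndc//; apply: integrableS ig => //.
  by move=> u /=; rewrite !in_itv/= => /andP[-> /ltW/le_trans]; apply.
have ccut n : continuous (cutoff n) by exact/smooth_continuous/smooth_cutoff.
have mg : measurable_fun `[a, b] (EFin \o g) by exact: (measurable_int mu).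
have [] := @dominated_convergence _ _ _ mu `[a, b] (measurable_itv _)
  (fun n u => (cutoff n u * g u)%:E) (fun u => (\1_`]a, t[ u * g u)%:E)
  (fun u => (`|g u|)%:E).
- move=> n; apply: measurable_int; exact: integrable_continuousM.
- apply/measurable_EFinP; apply: measurable_funM; last exact/measurable_EFinP.
  exact: measurable_indic.
- apply: aeW => u _; apply: cvg_EFin; first exact: nearW.
  by apply: cvgM; [exact: cvg_cutoff|exact: cvg_cst].
- exact: integrable_norm.
- apply: aeW => u n _; rewrite lee_fin normrM ler_piMl//; exact: cutoff_norm_le1.
move=> iind _ cv.
apply: fine_cvg; rewrite fineK//; exact: integrable_fin_num.
Qed.

End cutoff.

Lemma du_bois_reymond a b f g t : {within `[a, b], continuous f} ->
  mu.-integrable `[a, b] (EFin \o g) ->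
  (forall phi, test_function a b phi ->
     \int[mu]_(u in `[a, b]) (derive1 phi u * f u) =
     - \int[mu]_(u in `[a, b]) (phi u * g u)) ->
  a <= t <= b -> f t - f a = \int[mu]_(u in `[a, t]) g u.
Proof.
(* The cutoffs require [a < t]; for [t = a] both sides are zero. *)
move=> cf ig fg /andP[]; rewrite le_eqVlt => /predU1P[<- _|at_ tb].
  by rewrite subrr set_itv1 Rintegral_set1.
have c1 := cvg_integral_derive_cutoff at_ tb cf.
have c2 := cvgN (cvg_integral_cutoff at_ tb ig).
have c3 : \int[mu]_(u in `[a, b]) (derive1 (cutoff a t n) u * f u)
    @[n --> \oo] --> - \int[mu]_(u in `[a, t]) g u.
  under eq_fun => n do rewrite (fg _ (test_function_cutoff at_ n tb)).
  exact: c2.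
by apply: oppr_inj; rewrite opprB; exact: (cvg_unique _ c1 c3).
Qed.

End DuBoisReymond.

(** * Taylor's formula for one coordinate [y] with weak derivatives [y1] and [y2] *)

Section ScalarTaylor.
Context {R : realType}.
Implicit Types (f g phi p : R -> R) (a b c d s t u : R).
Notation mu := (@lebesgue_measure R).

Lemma smooth_subl s : smooth (fun u : R => s - u).
Proof.
apply/smoothP => k.
have : derivable_upto k (fun u : R => id (-1 * u + s)).
  apply: (@derivable_upto_affine _ k id (-1) s); case: k => //= k; split.
    by move=> x; exact: derivable_id.
  rewrite (_ : derive1 _ = cst (1 : R)); first exact: derivable_upto_cst.
  by apply/funext => x; exact: derive1_id.
by congr (derivable_upto _ _); apply/funext => u; rewrite mulN1r addrC.
Qed.

Lemma derive1_subl s u : derive1 (fun u : R => s - u) u = -1.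
Proof.
have -> : (fun u : R => s - u) = cst s \+ (fun u => -1 * id u).
  by apply/funext => v; rewrite /= mulN1r.
have di := @derivable_id R R u 1.
have dN := derivableM (@derivable_cst R R R (-1 : R) u 1) di.
rewrite (derive1D (@derivable_cst R R R s u 1) dN).
rewrite (derive1M (@derivable_cst R R R (-1 : R) u 1) di).
by rewrite !derive1_cst derive1_id mulr0 addr0 add0r mulr1.
Qed.

Variables (a b : R) (y y1 y2 : R -> R).
Hypothesis cy : {within `[a, b], continuous y}.
Hypothesis cy1 : {within `[a, b], continuous y1}.
Hypothesis iy2 : mu.-integrable `[a, b] (EFin \o y2).
Hypothesis weak1 : forall phi, test_function a b phi ->
  \int[mu]_(u in `[a, b]) (derive1 phi u * y u) =
  - \int[mu]_(u in `[a, b]) (phi u * y1 u).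
Hypothesis weak2 : forall phi, test_function a b phi ->
  \int[mu]_(u in `[a, b]) (derive1 (derive1 phi) u * y u) =
  \int[mu]_(u in `[a, b]) (phi u * y2 u).

(** [y2] is given only as second weak derivative of [y]. Testing [weak1] with [derive1 phi] shows
    that it is also the first weak derivative of [y1]. *)
Let weak12 phi : test_function a b phi ->
  \int[mu]_(u in `[a, b]) (derive1 phi u * y1 u) =
  - \int[mu]_(u in `[a, b]) (phi u * y2 u).
Proof.
move=> tphi; apply: oppr_inj; rewrite opprK -weak2//.
by rewrite weak1//; exact: test_function_derive.
Qed.

Lemma taylor0 s : a <= s <= b -> y1 s = y1 a + \int[mu]_(u in `[a, s]) y2 u.
Proof. by move=> /(du_bois_reymond cy1 iy2 weak12) <-; rewrite addrC subrK. Qed.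

Lemma taylor1 s : a <= s <= b ->
  y s = y a + (s - a) * y1 a + \int[mu]_(u in `[a, s]) ((s - u) * y2 u).
Proof.
move=> asb; have [as_ sb] := andP asb.
have cp : continuous (fun u : R => s - u).
  by apply: smooth_continuous; exact: smooth_subl.
have iy1 : mu.-integrable `[a, b] (EFin \o y1) by exact: continuous_itv_integrable.
have ipy2 : mu.-integrable `[a, b] (EFin \o ((fun u => s - u) \* y2)).
  exact: integrable_continuousM.
(* The product rule's candidate for the weak derivative of [(s - u) * y1 u], a function that
   vanishes at [u = s] and equals [(s - a) * y1 a] at [u = a]. *)
pose g := fun u => (s - u) * y2 u - y1 u.
have ig : mu.-integrable `[a, b] (EFin \o g).
  have /(_ (measurable_itv _)) := fun m => integrableB m ipy2 iy1.
  by apply: eq_integrable => // u _; rewrite /= EFinB.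
have cf : {within `[a, b], continuous (fun u => (s - u) * y1 u)}.
  apply: (@within_continuousM _ _ _ (fun u => s - u)) => //.
  exact: continuous_subspaceT.
have weakg phi : test_function a b phi ->
    \int[mu]_(u in `[a, b]) (derive1 phi u * ((s - u) * y1 u)) =
    - \int[mu]_(u in `[a, b]) (phi u * g u).
  move=> tphi; have [phis _ _] := tphi.
  have tp := test_functionM tphi (@smooth_subl s).
  have cphi : continuous phi by exact: smooth_continuous.
  have cd : continuous (derive1 (phi \* (fun u => s - u))).
    by apply: smooth_continuous; apply: smooth_derive; case: tp.
  have i1 := integrable_continuousM cphi iy1.
  have i2 := integrable_continuousM cphi ipy2.
  have i3 := integrable_continuousM cd iy1.
  (* The factor [s - u] is absorbed into the test function:
     [(phi * (s - u))' = phi' * (s - u) - phi], so [weak12] applies to the product. *)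
  transitivity (\int[mu]_(u in `[a, b])
      (derive1 (phi \* (fun u => s - u)) u * y1 u + phi u * y1 u)).
    apply: eq_Rintegral => u _.
    have d1 := phis 0%N u; have d2 := @smooth_subl s 0%N u.
    by rewrite (derive1M d1 d2) derive1_subl/=; ring.
  rewrite RintegralD// weak12//.
  rewrite [in RHS](_ : (fun u => _) = (fun u => phi u * ((s - u) * y2 u) - phi u * y1 u)).
    rewrite RintegralB// opprB addrC; congr (_ - _).
    by apply: eq_Rintegral => u _; rewrite /= mulrA.
  by apply/funext => u; rewrite /g mulrBr.
have := du_bois_reymond cf ig weakg asb.
have sub : (`[a, s] : set R) `<=` `[a, b].
  by move=> u /=; rewrite !in_itv/= => /andP[-> /le_trans]; apply.
rewrite RintegralB//; [|exact: integrableS ipy2|exact: integrableS iy1].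
(* The integral of [y1] left over from [g] is [y s - y a], which brings [y] into the identity. *)
rewrite -(du_bois_reymond cy iy1 weak1 asb).
rewrite subrr mul0r sub0r => E.
by apply/eqP; rewrite -subr_eq0; apply/eqP; move: E; lra.
Qed.

End ScalarTaylor.

(** * From scalar coordinates to vectors and matrix kernels *)

Section Vector.
Context {R : realType} {n : nat}.
Implicit Types (a b s : R) (f g x : R -> 'cV[R]_n).
Notation mu := (@lebesgue_measure R).

(** On a bounded interval [1 + F^2] is integrable, and it dominates [|F|] because
    [(|F| - 1)^2 >= 0]. *)
Lemma in_L2_integrable a b f i : in_L2 a b f ->
  mu.-integrable `[a, b] (EFin \o (fun t => f t i 0)).
Proof.
move=> /(_ i); set F := patch _ _ _ => FL.
have iF2 : mu.-integrable `[a, b] (EFin \o (fun t => F t ^+ 2)).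
  have := Lfun2_integrable_sqr FL; exact: integrableS.
have i1 : mu.-integrable `[a, b] (EFin \o cst 1).
  by apply: continuous_itv_integrable; apply: continuous_subspaceT => t; exact: cvg_cst.
have iD : mu.-integrable `[a, b] (EFin \o (fun t => 1 + F t ^+ 2)).
  have /(_ (measurable_itv _)) := fun m => integrableD m i1 iF2.
  by apply: eq_integrable.
have mF : measurable_fun `[a, b] F.
  by move: FL; rewrite inE => /andP[/[!inE]/= mF _]; exact: measurable_funTS.
have : mu.-integrable `[a, b] (EFin \o F).
  apply: le_integrable iD => //; first exact/measurable_EFinP.
  move=> t _ /=; rewrite lee_fin [leRHS]ger0_norm; last first.
    by rewrite addr_ge0// sqr_ge0.
  rewrite -[F t ^+ 2]real_normK ?num_real//.
  by have := sqr_ge0 (`|F t| - 1); have := normr_ge0 (F t); nra.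
by apply: eq_integrable => // t; rewrite inE/= => tab; rewrite /F patchE mem_set.
Qed.

Lemma within_continuous_coord a b f i : {within `[a, b], continuous f} ->
  {within `[a, b], continuous (fun t => f t i 0)}.
Proof.
move=> cf t; apply: (@cvg_comp _ _ _ f (fun M : 'cV[R]_n => M i 0)); first exact: cf.
exact: coord_continuous.
Qed.

Lemma integral_cVE a b f i :
  integral_cV a b f i 0 = \int[mu]_(t in `[a, b]) f t i 0.
Proof. by rewrite mxE. Qed.

Lemma weak_derivative_coord a b j f g i : weak_derivative a b j f g ->
  forall phi, test_function a b phi ->
  \int[mu]_(t in `[a, b]) (derive1n j phi t * f t i 0) =
  (-1) ^+ j * \int[mu]_(t in `[a, b]) (phi t * g t i 0).
Proof.
move=> [_ _ h] phi /h /matrixP /(_ i 0).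
rewrite integral_cVE !mxE.
under eq_Rintegral do rewrite mxE.
by under [in RHS]eq_Rintegral do rewrite mxE.
Qed.

Lemma weak_taylor a b (x xs xss : R -> 'cV[R]_n) :
  {within `[a, b], continuous x} ->
  weak_derivative a b 1 x xs -> {within `[a, b], continuous xs} ->
  weak_derivative a b 2 x xss ->
  forall s, a <= s <= b ->
    x s = x a + (s - a) *: xs a
      + integral_cV a s (fun eta => (s - eta) *: xss eta) /\
    xs s = xs a + integral_cV a s xss.
Proof.
move=> cx w1 cxs w2 s asb.
have iss i : mu.-integrable `[a, b] (EFin \o (fun t => xss t i 0)).
  by apply: in_L2_integrable; case: w2.
have w1' i phi : test_function a b phi ->
    \int[mu]_(u in `[a, b]) (derive1 phi u * x u i 0) =
    - \int[mu]_(u in `[a, b]) (phi u * xs u i 0).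
  by move=> /(weak_derivative_coord i w1); rewrite expr1 mulN1r.
have w2' i phi : test_function a b phi ->
    \int[mu]_(u in `[a, b]) (derive1 (derive1 phi) u * x u i 0) =
    \int[mu]_(u in `[a, b]) (phi u * xss u i 0).
  by move=> /(weak_derivative_coord i w2); rewrite sqrrN expr1n mul1r.
have cx' i := @within_continuous_coord a b x i cx.
have cxs' i := @within_continuous_coord a b xs i cxs.
split; apply/colP => i.
  rewrite !mxE (taylor1 (cx' i) (cxs' i) (iss i) (w1' i) (w2' i) asb).
  by congr (_ + _); apply: eq_Rintegral => u _; rewrite mxE.
by rewrite !mxE (taylor0 (cxs' i) (iss i) (w1' i) (w2' i) asb).
Qed.

Lemma Rintegral_sum a b (I : Type) (r : seq I) (F : I -> R -> R) :
  (forall k, mu.-integrable `[a, b] (EFin \o F k)) ->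
  \int[mu]_(t in `[a, b]) (\sum_(k <- r) F k t) =
  \sum_(k <- r) \int[mu]_(t in `[a, b]) F k t.
Proof.
move=> iF.
have is_ (r' : seq I) :
    mu.-integrable `[a, b] (EFin \o (fun t => \sum_(k <- r') F k t)).
  have /(_ (measurable_itv _)) := fun m =>
    integrable_sum m r' (P := xpredT) (fun k _ => iF k).
  by apply: eq_integrable => // t _; rewrite /= sumEFin.
elim: r => [|k r IH].
  rewrite big_nil (@eq_Rintegral _ _ _ _ _ (cst 0)) ?Rintegral_cst ?mul0r//.
  by move=> t _; rewrite big_nil.
rewrite big_cons -IH -RintegralD//.
by apply: eq_Rintegral => t _; rewrite big_cons.
Qed.

(** [mxBa] and [mxBb] are affine in the integration variable with constant matrix coefficients, so
    their integrals against [xss] depend only on the two moments [J] and [K] of the final proof. *)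
Lemma integral_cV_affine a b (P Q : 'M[R]_n) f : in_L2 a b f ->
  integral_cV a b (fun t => ((b - t) *: P + Q) *m f t) =
  P *m integral_cV a b (fun t => (b - t) *: f t) + Q *m integral_cV a b f.
Proof.
move=> fL; apply/colP => i; rewrite !mxE.
have i1 k : mu.-integrable `[a, b] (EFin \o (fun t => f t k 0)).
  exact: in_L2_integrable.
have cp : continuous (fun t : R => b - t).
  by apply: smooth_continuous; exact: smooth_subl.
have i2 k : mu.-integrable `[a, b] (EFin \o (fun t => (b - t) * f t k 0)).
  exact: (integrable_continuousM cp (i1 k)).
have cc (c : R) : continuous (cst c : R -> R) by move=> t; exact: cvg_cst.
have i3 c k := integrable_continuousM (cc c) (i1 k).
have i4 c k := integrable_continuousM (cc c) (i2 k).
rewrite -big_split/=.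
transitivity (\int[mu]_(t in `[a, b])
    (\sum_(k < n) (P i k * ((b - t) * f t k 0) + Q i k * f t k 0))).
  apply: eq_Rintegral => t _; rewrite mxE; apply: eq_bigr => k _.
  by rewrite !mxE; ring.
rewrite Rintegral_sum; last first.
  move=> k; have /(_ (measurable_itv _)) :=
    fun m => integrableD m (i4 (P i k) k) (i3 (Q i k) k).
  by apply: eq_integrable.
apply: eq_bigr => k _.
rewrite RintegralD//; [|exact: (i4 (P i k) k)|exact: (i3 (Q i k) k)].
rewrite !RintegralZl// !mxE; congr (_ * _ + _).
by apply: eq_Rintegral => t _; rewrite mxE.
Qed.

End Vector.

(** * Elimination of the values at [a] through the boundary condition *)

Theorem theorem3 (R : realType) (n : nat) (a b : R)
    (B : 'M[R]_(n + n, (n + n) + (n + n))) (x xs xss : R -> 'cV[R]_n) :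
  (1 <= n)%N -> a < b ->
  sobolev2 a b 3 x ->
  {within `[a, b], continuous x} ->
  weak_derivative a b 1 x xs -> {within `[a, b], continuous xs} ->
  weak_derivative a b 2 x xss ->
  \rank B = (n + n)%N ->
  mxB2 a b B \in unitmx ->
  B *m col_mx (col_mx (x a) (x b)) (col_mx (xs a) (xs b)) = 0 ->
  forall s, s \in `[a, b] ->
    x s = integral_cV a b (fun eta => mxBa a b B s eta *m xss eta)
          + integral_cV a s (fun eta => (s - eta) *: xss eta)
    /\
    xs s = integral_cV a b (fun eta => mxBb a b B eta *m xss eta)
           + integral_cV a s xss.
Proof.
move=> _ ab _ cx w1 cxs w2 _ B2u bc s; rewrite in_itv/= => asb.
have taylor := weak_taylor cx w1 cxs w2.
have [xsE xssE] := taylor s asb.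
have ssL : in_L2 a b xss by case: w2.
have bab : a <= b <= b by rewrite lexx ltW.
have [xb xsb] := taylor b bab.
set J := integral_cV a b (fun eta => (b - eta) *: xss eta) in xb.
set K := integral_cV a b xss in xsb.
have bdry : col_mx (x a) (xs a) = mxB3 a b B *m col_mx J K.
  (* Invertibility of [mxB2] reduces the claim to [mxB2 *m (x a, xs a) + B *m (0, J, 0, K) = 0]. *)
  rewrite /mxB3 !mulNmx -mulmxA -mulmxN; apply: (canRL (mulKmx B2u)).
  apply/eqP; rewrite -addr_eq0; apply/eqP.
  (* Both terms are [B] times a stacked vector; by Taylor's formula at [b] these add up to
     [(x a, x b, xs a, xs b)], which [B] annihilates. *)
  rewrite /mxB2 -!mulmxA -mulmxDr -[RHS]bc; congr (B *m _).
  rewrite !mul_col_mx !mul_row_col !mul1mx !mul0mx !addr0 !add0r.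
  by rewrite !add_col_mx !addr0 mul_scalar_mx xb xsb.
(* The Taylor polynomial at [s] is the block row [[I, (s - a) I]] applied to [(x a, xs a)], the same
   row that defines [mxB45]. *)
have eqx : x a + (s - a) *: xs a = mxB4 a b B s *m J + mxB5 a b B s *m K.
  rewrite -mul_row_col hsubmxK /mxB45 -mulmxA -bdry mul_row_col mul1mx.
  by rewrite mul_scalar_mx.
have eqxs : xs a = mxB6 a b B *m J + mxB7 a b B *m K.
  by rewrite -mul_row_col hsubmxK /mxB67 -mulmxA -bdry mul_row_col mul1mx mul0mx add0r.
by rewrite xsE xssE eqx eqxs /mxBa /mxBb !integral_cV_affine.
Qed.
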